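(* The variety of commutative, idempotent, medial groupoids satisfying the pentagonal identity $(xy\cdot x)y\cdot x=y$ is the variety of commutative pentagonal quasigroups, and the spectrum of this variety is $\{11^n:n=0,1,2,\ldots\}$.
   Context: A groupoid is a nonempty set with a binary operation, written as juxtaposition. It is commutative if $xy=yx$, idempotent if $xx=x$, medial if $(xy)(zu)=(xz)(yu)$, for all elements. The pentagonal identity $(xy\cdot x)y\cdot x=y$ means $\big(((xy)x)y\big)x=y$. A pentagonal quasigroup is a quasigroup which is idempotent, medial and satisfies the pentagonal identity. The spectrum of a variety is the set of cardinalities of its finite members. *)

(* Defs.v *)
From mathcomp Require Import all_boot monoid.
Set Implicit Arguments.
Unset Strict Implicit.
Unset Printing Implicit Defensive.

Local Open Scope group_scope.

(* The empty type is a magmaType, hence the nonemptiness field. *)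
Record groupoid : Type := Groupoid {
  groupoid_magma :> magmaType;
  groupoid_nonempty : inhabited groupoid_magma
}.

Definition gcommutative (G : groupoid) : Prop :=
  forall x y : G, x * y = y * x.

Definition gidempotent (G : groupoid) : Prop :=
  forall x : G, x * x = x.

Definition gmedial (G : groupoid) : Prop :=
  forall x y z u : G, (x * y) * (z * u) = (x * z) * (y * u).

Definition gpentagonal (G : groupoid) : Prop :=
  forall x y : G, (((x * y) * x) * y) * x = y.

Definition quasigroup (G : groupoid) : Prop :=
  (forall a b : G, exists! x : G, a * x = b) /\
  (forall a b : G, exists! y : G, y * a = b).

Definition pentagonal_quasigroup (G : groupoid) : Prop :=
  [/\ quasigroup G, gidempotent G, gmedial G & gpentagonal G].

Definition comm_pentagonal_quasigroup (G : groupoid) : Prop :=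
  gcommutative G /\ pentagonal_quasigroup G.

Definition comm_idem_medial_pentagonal (G : groupoid) : Prop :=
  [/\ gcommutative G, gidempotent G, gmedial G & gpentagonal G].

Definition spectrum (V : groupoid -> Prop) (n : nat) : Prop :=
  exists2 G : groupoid, V G & exists f : 'I_n -> G, bijective f.

(* Main.v *)
Require Import Defs.
From mathcomp Require Import all_boot.
From HB Require Import structures.
From mathcomp Require Import fingroup ssralg zmodp matrix pgroup abelian ring.

Set Implicit Arguments.
Unset Strict Implicit.
Unset Printing Implicit Defensive.

(** A commutative idempotent medial groupoid is distributive, because
    [z * (x * y) = (z * z) * (x * y) = (z * x) * (z * y)].  Distributing the
    last multiplication in the pentagonal identity turns it into
    [(((x * y) * x) * x) * (x * y) = y].  The left-hand side sees [y] only
    through [x * y], so it is a formula for dividing by [x]; this gives the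
    quasigroup property ([divE], [mul_div]).

    For the spectrum, the operation is thought of as taking midpoints.  Fix an
    origin [e]; then [e * x] is half of [x], division by [e] is doubling, and
    [x + y], defined as twice the midpoint [x * y], is an abelian group law
    with zero [e], associativity being an instance of mediality.  The
    pentagonal identity at the origin says [y = ((y / 4) + y) / 4], that is,
    [16 y = 5 y], so the group has exponent dividing 11 ([add11]); a finite one
    has order a power of 11 ([card_exponent_dvd_prime]).  Conversely 2 is
    invertible modulo 11 with inverse 6, and [6 (x + y)] satisfies all the
    identities on the vectors of length [n] over the field with 11 elements. *)

Section Division.

Local Open Scope group_scope.

Variable G : groupoid.
Hypothesis mulC : gcommutative G.
Hypothesis mulI : gidempotent G.
Hypothesis mulM : gmedial G.
Hypothesis mulP : gpentagonal G.

Implicit Types x y z w : G.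

Definition div x w : G := ((w * x) * x) * w.

Lemma mul_distr z x y : z * (x * y) = (z * x) * (z * y).
Proof. by rewrite -{1}(mulI z) mulM. Qed.

(** This is the pentagonal identity with its outermost product distributed. *)
Lemma divE x y : div x (x * y) = y.
Proof.
by rewrite -[RHS](mulP x) /div [RHS]mulC [RHS]mul_distr [x * (_ * x)]mulC.
Qed.

Lemma mul_div x w : x * div x w = w.
Proof.
(* Left multiplication by [x] is an endomorphism fixing [x], so it commutes
   with the polynomial [div x]. *)
have morph_div : x * div x w = div x (x * w).
  by rewrite /div !(mul_distr x) !mulI.
by rewrite morph_div divE.
Qed.

Lemma quasigroup_of_identities : quasigroup G.
Proof.
have mulVx a b : exists! x : G, a * x = b.
  exists (div a b); split; first exact: mul_div.
  by move=> x <-; rewrite divE.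
split=> // a b; have [x [ax_b uniq_x]] := mulVx a b.
exists x; split; first by rewrite mulC.
by move=> y ya_b; apply: uniq_x; rewrite mulC.
Qed.

Variable e : G.

Definition add x y : G := div e (x * y).

Lemma half_add x y : e * add x y = x * y.
Proof. exact: mul_div. Qed.

Lemma half_inj x y : e * x = e * y -> x = y.
Proof. by move=> eq_ex; rewrite -(divE e x) eq_ex divE. Qed.

Lemma add0x : left_id e add.
Proof. by move=> x; apply: divE. Qed.

Lemma addC : commutative add.
Proof. by move=> x y; rewrite /add mulC. Qed.

(** Halving both sides twice leaves [(x * y) * (e * z) = (x * e) * (y * z)]. *)
Lemma addA : associative add.
Proof.
move=> x y z; apply: half_inj; rewrite !half_add; apply: half_inj.
by rewrite [LHS]mul_distr [RHS]mul_distr !half_add [RHS]mulM (mulC x e).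
Qed.

Lemma addNx : left_inverse e (fun x => div x e) add.
Proof. by move=> x; rewrite /add mulC mul_div -{2}(mulI e) divE. Qed.

Lemma double_half x : add (e * x) (e * x) = x.
Proof. by rewrite /add mulI divE. Qed.

(** Solving the pentagonal identity for [e] and [x], [x = ((x / 4) + x) / 4],
    by doubling gives [16 x = x + 4 x]; cancelling leaves [11 x = 0]. *)
Lemma add11 x : iterop 11 add x e = e.
Proof.
pose dbl y := add y y.
have dblE y : dbl (e * y) = y by apply: double_half.
have dblD y z : dbl (add y z) = add (dbl y) (dbl z).
  by rewrite /dbl !addA -(addA y z) (addC z) !addA.
have quarters : x = e * (e * add (e * (e * x)) x).
  by rewrite half_add -{1}(mulP e x) -[RHS]mulC (mulC (e * x)).
have sixteen_five : dbl (dbl (dbl (dbl x))) = add x (dbl (dbl x)).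
  by rewrite {1}quarters !dblE (dblD _ x) (dblD _ (dbl x)) !dblE.
have cancel y z : add y z = y -> z = e.
  by move=> yz_y; rewrite -(add0x z) -(addNx y) -addA yz_y.
apply: (cancel (add x (dbl (dbl x)))).
by rewrite -{2}sixteen_five /dbl /= -!addA.
Qed.

End Division.

(** By Cauchy's theorem no prime other than [p] divides the order.  The group
    law is an explicit argument because the one on a groupoid depends on the
    choice of an origin. *)
Lemma card_exponent_dvd_prime (T : finType) (p : nat)
    (op : T -> T -> T) (one : T) (inv : T -> T) :
  prime p -> associative op -> commutative op -> left_id one op ->
  left_inverse one inv op -> (forall x, iterop p op x one = one) ->
  exists n, #|T| = p ^ n.
Proof.
move=> p_pr opA opC op1 opV expp.
have op1r : right_id one op by move=> x; rewrite opC.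
have opVr : right_inverse one inv op by move=> x; rewrite opC.
pose gT : finGroupType :=
  HB.pack (Finite.sort T) (isGroup.Build T opA op1 op1r opV opVr).
have : (p.-group [set: gT])%g.
  rewrite -pnat_exponent (pnat_dvd _ (pnat_id p_pr)) //.
  by apply/exponentP=> x _; apply: expp.
move/p_natP=> [n]; rewrite cardsT => card_gT; exists n; rewrite -card_gT.
by apply: (@bij_eq_card T gT id); exists id.
Qed.

(** The group on [G] is carried over to ['I_m], where cardinals make sense. *)
Lemma spectrum_card m :
  spectrum comm_idem_medial_pentagonal m -> exists n, m = 11 ^ n.
Proof.
case=> G [mulC mulI mulM mulP] [f [g fK gK]].
have [e] := groupoid_nonempty G.
pose addI i j := g (add e (f i) (f j)).
have [|||||i|n] := @card_exponent_dvd_prime 'I_m 11 addI (g e)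
  (fun i => g (div (f i) e)).
- by [].
- by move=> i j k; rewrite /addI !gK addA.
- by move=> i j; rewrite /addI addC.
- by move=> i; rewrite /addI gK add0x ?fK.
- by move=> i; rewrite /addI gK addNx.
- apply: (can_inj fK); rewrite gK -[RHS](add11 mulC mulI mulM mulP e (f i)).
  by rewrite /= /addI !gK.
- by rewrite card_ord => ->; exists n.
Qed.

Section Midpoint11.

Import GRing.Theory.
Local Open Scope ring_scope.

Variable n : nat.

(** The alias keeps the midpoint operation apart from any multiplication that
    row vectors already carry. *)
Definition midpoint11 : Type := 'rV['F_11]_n.

Definition mid (x y : midpoint11) : midpoint11 := \row_i (6 * (x 0 i + y 0 i)).

HB.instance Definition _ := hasMul.Build midpoint11 mid.

Definition midpoint11_groupoid : groupoid :=
  @Groupoid midpoint11 (inhabits (0 : 'rV['F_11]_n)).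

Lemma midpoint11P : comm_idem_medial_pentagonal midpoint11_groupoid.
Proof.
have F11 : 11%:R = 0 :> 'F_11 by apply/eqP.
(* The constants are integers until [11 = 0] is used, so the computations take
   place in an arbitrary commutative ring. *)
have [half_idem half_pent] :
    (forall a : 'F_11, 6 * (a + a) = a) /\
    (forall a b : 'F_11,
       6 * (6 * (6 * (6 * (a + b) + a) + b) + a) = b).
  move: F11; move: ('F_11 : comPzRingType) => R R11; split=> [a|a b].
    have -> : 6 * (a + a) = a + 11%:R * a by ring.
    by rewrite R11 mul0r addr0.
  (* The left-hand side is [1518 a + 1332 b]. *)
  have -> : 6 * (6 * (6 * (6 * (a + b) + a) + b) + a) =
            b + 11%:R * (138%:R * a + 121%:R * b) by ring.
  by rewrite R11 mul0r addr0.
split=> [x y|x|x y z u|x y]; apply/rowP=> i; rewrite !mxE //.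
- by rewrite addrC.
- by rewrite -!mulrDr addrACA.
Qed.

End Midpoint11.

Lemma spectrum_pow11 n : spectrum comm_idem_medial_pentagonal (11 ^ n).
Proof.
exists (midpoint11_groupoid n); first exact: midpoint11P.
have <- : #|{: 'rV['F_11]_n}| = 11 ^ n by rewrite card_mx card_Fp // mul1n.
by exists enum_val; apply: enum_val_bij.
Qed.

Theorem corollary3p10 :
  (forall G : groupoid,
     comm_idem_medial_pentagonal G <-> comm_pentagonal_quasigroup G) /\
  (forall m : nat,
     spectrum comm_idem_medial_pentagonal m <-> exists n : nat, m = 11 ^ n).
Proof.
split=> [G|m]; split.
- case=> mulC mulI mulM mulP; split=> //; split=> //.
  exact: quasigroup_of_identities.
- by case=> mulC [_ mulI mulM mulP].
- exact: spectrum_card.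
- by case=> n ->; apply: spectrum_pow11.
Qed.
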